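(* Let $M\geq 2$ be an integer and let $q$ be a prime power with $(q,M)=1$. Then, as formal power series in $u$, $$1+\sum_{n=1}^{\infty} c(n,q,M)_{\mathrm{rg}}\,u^n=\prod_{d\geq 1}(1-u^d)^{-N_M(q,d)},$$ $$1+\sum_{n=1}^{\infty} c(n,q,M)_{\mathrm{rs}}\,u^n=\prod_{d\geq 1}(1+u^d)^{N_M(q,d)}.$$
   Context: $\mathbb F_q$ is the field with $q$ elements and $\mathrm{GL}(n,q)$ the group of invertible $n\times n$ matrices over it. $\Phi$ is the set of all monic irreducible polynomials of degree $\geq 1$ over $\mathbb F_q$ other than the polynomial $x$. A conjugacy class of $\mathrm{GL}(n,q)$ (or any $\alpha$ in it) is determined by its combinatorial data: distinct $f_1,\dots,f_l\in\Phi$ with non-empty partitions $\lambda_{f_i}=(\lambda_{i_1},\lambda_{i_2},\dots)$ satisfying $\sum_i|\lambda_{f_i}|\deg f_i=n$, meaning that the $\mathbb F_q[x]$-module $\mathbb F_q^n$ defined by $\alpha$ is isomorphic to $\bigoplus_{i,j}\mathbb F_q[x]/(f_i^{\lambda_{i_j}})$. The element $\alpha$ (and its class) is regular if every $\lambda_{f_i}$ has a single part, and regular semisimple if every $\lambda_{f_i}=(1)$. $c(n,q,M)_{\mathrm{rg}}$ (resp. $c(n,q,M)_{\mathrm{rs}}$) is the number of regular (resp. regular semisimple) conjugacy classes of $\mathrm{GL}(n,q)$ contained in the image of the power map $\mathrm{GL}(n,q)\to\mathrm{GL}(n,q)$, $x\mapsto x^M$. A monic irreducible polynomial $f(x)\in\mathbb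 F_q[x]$ is an M-power polynomial if $f(x^M)$ has an irreducible factor of degree $\deg f$. $N_M(q,d)$ is the number of M-power polynomials of degree $d$ in $\Phi$. *)

(* Defs.v *)
From HB Require Import structures.
From mathcomp Require Import all_boot all_order all_fingroup all_algebra.
From mathcomp Require Import boolp.

Set Implicit Arguments.
Unset Strict Implicit.
Unset Printing Implicit Defensive.
Import GRing.Theory.
Local Open Scope ring_scope.

(** * Formal power series *)

(* A record rather than [nat -> R] itself, so that the pointwise ring structure
   of functions is never found by canonical structure inference. *)
Record fps (R : Type) := Fps { fps_coef : nat -> R }.

Lemma fpsP (R : Type) (f g : fps R) : fps_coef f =1 fps_coef g <-> f = g.
Proof.
split=> [|->//]; case: f g => [f] [g] /= fg; congr Fps; exact/funext.
Qed.

HB.instance Definition _ (R : Type) := gen_eqMixin (fps R).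
HB.instance Definition _ (R : Type) := gen_choiceMixin (fps R).

Section FpsRing.
Variable R : comNzRingType.
Implicit Types f g h : fps R.

Definition fps_zero : fps R := Fps (fun=> 0).
Definition fps_one : fps R := Fps (fun n => (n == 0)%:R).
Definition fps_add f g := Fps (fun n => fps_coef f n + fps_coef g n).
Definition fps_opp f := Fps (fun n => - fps_coef f n).
Definition fps_mul f g :=
  Fps (fun n => \sum_(i < n.+1) fps_coef f i * fps_coef g (n - i)).

Fact fps_addA : associative fps_add.
Proof. by move=> f g h; apply/fpsP => n /=; rewrite addrA. Qed.
Fact fps_addC : commutative fps_add.
Proof. by move=> f g; apply/fpsP => n /=; rewrite addrC. Qed.
Fact fps_add0 : left_id fps_zero fps_add.
Proof. by move=> f; apply/fpsP => n /=; rewrite add0r. Qed.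
Fact fps_addN : left_inverse fps_zero fps_opp fps_add.
Proof. by move=> f; apply/fpsP => n /=; rewrite addNr. Qed.

HB.instance Definition _ :=
  GRing.isZmodule.Build (fps R) fps_addA fps_addC fps_add0 fps_addN.

Definition fps_trunc (N : nat) f : {poly R} := \poly_(i < N) fps_coef f i.

Lemma fps_coefM_trunc f g (N n : nat) : (n < N)%N ->
  fps_coef (fps_mul f g) n = (fps_trunc N f * fps_trunc N g)`_n.
Proof.
move=> nN; rewrite coefM; apply: eq_bigr => i _; rewrite !coef_poly.
by rewrite (leq_ltn_trans _ nN) ?leq_ord// (leq_ltn_trans _ nN) ?leq_subr.
Qed.

Fact fps_mulC : commutative fps_mul.
Proof.
by move=> f g; apply/fpsP => n; rewrite !(@fps_coefM_trunc _ _ n.+1)// mulrC.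
Qed.

Fact fps_mulA : associative fps_mul.
Proof.
move=> f g h; apply/fpsP => n.
pose t := fps_trunc n.+1.
transitivity (t f * t g * t h)`_n.
  rewrite -mulrA coefM; apply: eq_bigr => i _.
  rewrite coef_poly ltn_ord; congr (_ * _).
  by rewrite (@fps_coefM_trunc _ _ n.+1)// ltnS leq_subr.
rewrite coefM; apply: eq_bigr => i _.
rewrite [(t h)`_ _]coef_poly ltnS leq_subr; congr (_ * _).
by rewrite -fps_coefM_trunc.
Qed.

Fact fps_mul1 : left_id fps_one fps_mul.
Proof.
move=> f; apply/fpsP => n /=; rewrite big_ord_recl /= mul1r subn0.
by rewrite big1 ?addr0// => i _; rewrite mul0r.
Qed.

Fact fps_mulDl : left_distributive fps_mul fps_add.
Proof.
move=> f g h; apply/fpsP => n /=; rewrite -big_split /=.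
by apply: eq_bigr => i _; rewrite mulrDl.
Qed.

Fact fps_1_neq0 : fps_one != 0 :> fps R.
Proof.
by apply/eqP => /fpsP/(_ 0)/= /eqP; rewrite oner_eq0.
Qed.

HB.instance Definition _ := GRing.Zmodule_isComNzRing.Build (fps R)
  fps_mulA fps_mulC fps_mul1 fps_mulDl fps_1_neq0.

Definition fps_unit f := `[< exists g, g * f = 1 >].
Definition fps_inv f :=
  if pselect (exists g, g * f = 1) is left e then projT1 (cid e) else f.

Fact fps_mulV : {in fps_unit, left_inverse 1 fps_inv *%R}.
Proof.
move=> f /asboolP fU; rewrite /fps_inv; case: pselect => // e.
exact: projT2 (cid e).
Qed.
Fact fps_unitP f g : g * f = 1 -> fps_unit f.
Proof. by move=> gf; apply/asboolP; exists g. Qed.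
Fact fps_inv_out : {in [predC fps_unit], fps_inv =1 id}.
Proof.
move=> f /negP fNU; rewrite /fps_inv; case: pselect => // e.
by case: fNU; apply/asboolP.
Qed.

HB.instance Definition _ := GRing.ComNzRing_hasMulInverse.Build (fps R)
  fps_mulV fps_unitP fps_inv_out.

(* The variable u. *)
Definition fpsX : fps R := Fps (fun n => (n == 1)%:R).

(* [S] is the infinite product [\prod_(d >= 1) G d], in the sense of u-adic
   convergence: every coefficient of the partial products is eventually
   constant, equal to the coefficient of [S]. *)
Definition fps_is_infprod (G : nat -> fps R) (S : fps R) : Prop :=
  forall n : nat, exists D0 : nat, forall D : nat, (D0 <= D)%N ->
    fps_coef (\prod_(1 <= d < D) G d) n = fps_coef S n.

Lemma fps_coefXn (d n : nat) : fps_coef (fpsX ^+ d) n = (n == d)%:R.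
Proof.
elim: d n => [|d IHd] n //; rewrite exprS; case: n => [|n].
  by rewrite /= big_ord_recl big_ord0 /= mul0r addr0.
rewrite /= big_ord_recl /= mul0r add0r big_ord_recl /= mul1r subSS subn0.
by rewrite IHd eqSS big1 ?addr0// => i _; rewrite mul0r.
Qed.

(* Hence [(1 - fpsX ^+ d) ^- N] is an actual inverse for d > 0. *)
Lemma fps_unit_1subXn (d : nat) :
  (0 < d)%N -> (1 - fpsX ^+ d : fps R) \is a GRing.unit.
Proof.
move=> d0; pose g : fps R := Fps (fun n => (d %| n)%:R).
apply/unitrPr; exists g; rewrite mulrBl mul1r; apply/fpsP => n.
have -> : fps_coef (g - fpsX ^+ d * g) n =
    fps_coef g n - fps_coef (fpsX ^+ d * g) n by [].
have -> : fps_coef (fpsX ^+ d * g) n =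
    \sum_(i < n.+1) fps_coef (fpsX ^+ d) i * fps_coef g (n - i) by [].
under eq_bigr do rewrite fps_coefXn /=.
have [dn|nd] := leqP d n.
  rewrite (bigD1 (Ordinal (dn : (d < n.+1)%N))) //= eqxx mul1r big1; last first.
    by move=> i; rewrite -val_eqE /= => /negPf->; rewrite mul0r.
  rewrite addr0 /= dvdn_subl// subrr.
  by rewrite (gtn_eqF (leq_trans d0 dn)).
rewrite big1 => [|i _]; last first.
  by rewrite (ltn_eqF (leq_trans (ltn_ord i) nd)) mul0r.
rewrite subr0 /=; case: n nd => [|n] nd; first by rewrite dvdn0.
by rewrite gtnNdvd.
Qed.

End FpsRing.

Arguments fpsX {R}.

(* 1 + \sum_(n >= 1) c n * u ^ n *)
Definition gen_series (c : nat -> nat) : fps int :=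
  1 + Fps (fun n => if n == 0%N then 0 else (c n)%:Z).

(** * Conjugacy classes of GL(n, q) and their combinatorial data *)

Section PowerClasses.
Variable F : finFieldType.

Definition in_Phi (f : {poly F}) : Prop :=
  [/\ f \is monic, irreducible_poly f & f != 'X].

Definition nonempty_partition (la : seq nat) : bool :=
  [&& la != [::], sorted geq la & all (leq 1) la].

(* A list of pairs (f_i, lambda_{f_i}). *)
Definition comb_data := seq ({poly F} * seq nat).

Definition elem_divisors (D : comb_data) : seq {poly F} :=
  [seq x.1 ^+ k | x <- D, k <- x.2].

(* The F[x]-module F^n defined by A (on column vectors, a polynomial p acting as
   p(A)) is isomorphic to the direct sum of the F[x]/(h), for h in s. *)
Definition module_iso (m : nat) (A : 'M[F]_m.+1) (s : seq {poly F}) : Prop :=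
  exists phi : 'cV[F]_m.+1 -> forall i : 'I_(size s), {poly %/ s`_i},
    [/\ bijective phi,
        forall (v w : 'cV[F]_m.+1) i, phi (v + w) i = phi v i + phi w i
      & forall (p : {poly F}) v i,
          phi (horner_mx A p *m v) i = in_qpoly s`_i p * phi v i].

Definition has_comb_data (m : nat) (A : 'M[F]_m.+1) (D : comb_data) : Prop :=
  [/\ uniq [seq x.1 | x <- D],
      forall x, x \in D -> in_Phi x.1 /\ nonempty_partition x.2,
      (\sum_(x <- D) sumn x.2 * (size x.1).-1 = m.+1)%N
    & module_iso A (elem_divisors D)].

Definition regular_mx (m : nat) (A : 'M[F]_m.+1) : Prop :=
  exists2 D, has_comb_data A D & all (fun x => size x.2 == 1%N) D.

Definition regular_semisimple_mx (m : nat) (A : 'M[F]_m.+1) : Prop :=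
  exists2 D, has_comb_data A D & all (fun x => x.2 == [:: 1%N]) D.

Definition power_image (M n : nat) : {set {'GL_n[F]}} :=
  [set (x ^+ M)%g | x in 'GL_n[F]%g].

(* {'GL_n[F]} consists of matrices of size n.-1.+1, which is n as soon as
   n >= 1; the value of the next two counts at n = 0 is irrelevant. *)
Definition c_rg (M n : nat) : nat :=
  #|[set C in classes 'GL_n[F]%g |
      `[< exists2 a : {'GL_n[F]}, a \in C & regular_mx (GLval a) >]
      && (C \subset power_image M n)]|.

Definition c_rs (M n : nat) : nat :=
  #|[set C in classes 'GL_n[F]%g |
      `[< exists2 a : {'GL_n[F]}, a \in C & regular_semisimple_mx (GLval a) >]
      && (C \subset power_image M n)]|.

(** * M-power polynomials *)

Definition M_power_poly (M : nat) (f : {poly F}) : Prop :=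
  [/\ f \is monic, irreducible_poly f &
      exists g : {poly F}, [/\ irreducible_poly g, g %| f \Po 'X^M
        & (size g).-1 = (size f).-1]].

(* Polynomials of degree d are counted inside the finite type {poly_d.+1 F} of
   polynomials of size at most d + 1. *)
Definition N_M (M d : nat) : nat :=
  #|[set f : {poly_d.+1 F} |
      `[< [/\ in_Phi f, M_power_poly M f & (size f).-1 = d] >]]|.

End PowerClasses.

(* Main.v *)
Require Import Defs.
From mathcomp Require Import all_boot all_order all_fingroup all_algebra.
From mathcomp Require Import all_solvable all_field.
From mathcomp Require Import boolp.

(** A matrix [A] of size [n] is regular exactly when the module that it defines is
    cyclic, that is, isomorphic to [F[X]/(h)] for a monic [h] of degree [n], by the
    Chinese remainder theorem ([regular_comb_dataP]).  The companion matrix of [h]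
    is a representative, so regular classes of [GL_n] correspond to the monic [h]
    of degree [n] prime to [X], and regular semisimple classes to the squarefree
    ones.

    A matrix that commutes with a cyclic [A] acts as a polynomial in [A].  Hence the
    class of [h] consists of [M]-th powers if and only if [X] is an [M]-th power
    modulo [h] ([card_regular_power_classes]).  By the Chinese remainder theorem
    this can be tested modulo the primary factors [f ^ k] of [h], and since [M] is
    prime to the characteristic, modulo the irreducible factors [f]
    ([M_power_lift]).  Finally, [X] is an [M]-th power in the field [F[X]/(f)] if
    and only if [f] is an [M]-power polynomial ([M_power_polyP]): an irreducible
    factor of [f(X ^ M)] of the degree of [f] is the minimal polynomial of an
    [M]-th root of [X].

    The theorem therefore counts monic polynomials, respectively squarefree ones,
    all of whose irreducible factors are [M]-power polynomials other than [X].
    By unique factorization each such [f] contributes a factor [1 / (1 - u ^ deg f)],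
    respectively [1 + u ^ deg f], to the generating function
    ([monic_series_supported], [monic_series_squarefree]).  The coefficient of
    [u ^ n] involves only factors [f] of degree at most [n], which gives the
    convergence of the product. *)

Set Implicit Arguments.
Unset Strict Implicit.
Unset Printing Implicit Defensive.
Import GRing.Theory.
Local Open Scope ring_scope.

(** * Factorization of polynomials over a field *)

Section Factorization.
Variable F : fieldType.
Implicit Types f g h p q : {poly F}.

Lemma irredp_dvdM f p q :
  irreducible_poly f -> (f %| p * q) = (f %| p) || (f %| q).
Proof.
move=> fI; apply/idP/orP => [fpq|[/dvdp_mulr|/dvdp_mull]//].
have [|fp] := boolP (f %| p); [by left | right].
by move: fpq; rewrite Gauss_dvdpr// irreducible_poly_coprime.
Qed.

Lemma irredp_dvd1 f : irreducible_poly f -> (f %| 1) = false.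
Proof. by case=> f1 _; rewrite dvdp1 gtn_eqF. Qed.

Lemma irredp_dvdX f p k : irreducible_poly f -> f %| p ^+ k -> f %| p.
Proof.
move=> fI; elim: k => [|k IHk]; first by rewrite irredp_dvd1.
by rewrite exprS irredp_dvdM// => /orP[].
Qed.

Lemma irredp_dvd_prod f (I : Type) (r : seq I) (P : I -> {poly F}) :
  irreducible_poly f -> f %| \prod_(i <- r) P i = has (fun i => f %| P i) r.
Proof.
move=> fI; elim: r => [|i r IHr]; first by rewrite big_nil irredp_dvd1.
by rewrite big_cons irredp_dvdM// IHr.
Qed.

Lemma irredp_monic_dvd f g : f \is monic -> g \is monic ->
  irreducible_poly f -> irreducible_poly g -> f %| g -> f = g.
Proof.
move=> fm gm [f1 _] gI fg; apply/eqP; rewrite -eqp_monic//.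
by apply: gI.2 => //; rewrite gtn_eqF.
Qed.

Lemma irredp_eqp f g : f %= g -> irreducible_poly f -> irreducible_poly g.
Proof.
move=> fg [f1 fI]; split=> [|q q1 qg]; first by rewrite -(eqp_size fg).
by apply: (eqp_trans _ fg); apply: fI => //; rewrite (eqp_dvdr _ fg).
Qed.

Lemma exists_irredp_dvd h : (1 < size h)%N ->
  exists f, [/\ f \is monic, irreducible_poly f & f %| h].
Proof.
have [n] := ubnP (size h); elim: n h => // n IHn h hn h1.
have h0 : h != 0 by rewrite -size_poly_gt0 ltnW.
have [hI|] := pselect (irreducible_poly h).
  exists ((lead_coef h)^-1 *: h).
  have hh : h %= (lead_coef h)^-1 *: h.
    by rewrite eqp_sym eqp_scale// invr_eq0 lead_coef_eq0.
  split; last by rewrite -(eqp_dvdl _ hh).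
    by rewrite monicE lead_coefZ mulVf// lead_coef_eq0.
  exact: irredp_eqp hh hI.
move=> hNI; have /existsNP[q /not_implyP[q1 /not_implyP[qh /negP qNh]]] :
    ~ (forall q, size q != 1 -> q %| h -> q %= h).
  by move=> hI; apply: hNI; split.
have q0 : q != 0 by apply: contraTneq qh => ->; rewrite dvd0p.
have qlt : (size q < size h)%N.
  by rewrite ltn_neqAle dvdp_leq// andbT dvdp_size_eqp.
have [||f [fm fI fq]] := IHn q; first exact: leq_trans qlt _.
  by rewrite ltn_neqAle eq_sym q1 size_poly_gt0.
by exists f; split=> //; apply: dvdp_trans fq qh.
Qed.

Lemma extract_power f h : (1 < size f)%N -> h != 0 ->
  exists k h1, h = f ^+ k * h1 /\ ~~ (f %| h1).
Proof.
move=> f1; have [n] := ubnP (size h); elim: n h => // n IHn h hn h0.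
have [/dvdpP[h1 Eh]|fNh] := boolP (f %| h); last first.
  by exists 0, h; rewrite expr0 mul1r.
have [f0 h10] : f != 0 /\ h1 != 0.
  by move: h0; rewrite Eh mulf_eq0 => /norP[].
have [|//|k [h2 [E fNh2]]] := IHn h1; last first.
  rewrite Eh E; exists k.+1, h2; split=> //.
  by rewrite exprSr mulrAC.
move: hn; rewrite ltnS; apply: leq_trans; rewrite Eh size_mul//.
by case: (size f) f1 => [|[|s]]// _; rewrite !addnS /= ltnS leq_addr.
Qed.

(** Exponents are stored as one-part partitions, so that a factorization of a
    polynomial prime to [X] is the combinatorial data of a regular class. *)
Definition regular_factorization (D : seq ({poly F} * seq nat)) h : Prop :=
  [/\ uniq [seq x.1 | x <- D],
      forall x, x \in D -> [/\ x.1 \is monic, irreducible_poly x.1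
        & exists2 k, (0 < k)%N & x.2 = [:: k]]
    & h = \prod_(x <- D) x.1 ^+ sumn x.2].

Lemma exists_regular_factorization h :
  h \is monic -> exists D, regular_factorization D h.
Proof.
have [n] := ubnP (size h); elim: n h => // n IHn h hn hm.
have h0 := monic_neq0 hm.
have [h1|h1] := leqP (size h) 1.
  exists [::]; split => //; rewrite big_nil.
  have /size_poly1P[c c0 E] : size h == 1.
    by rewrite eqn_leq h1 size_poly_gt0.
  by move: hm; rewrite E monicE lead_coefC => /eqP->.
have [f [fm fI fh]] := exists_irredp_dvd h1.
have [k [h2 [Eh fNh2]]] := extract_power fI.1 h0.
have k0 : (0 < k)%N.
  by case: k Eh => // Eh; move: fh; rewrite Eh mul1r (negPf fNh2).
have h2m : h2 \is monic by move: hm; rewrite Eh monicMl ?monic_exp.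
have [|//|D [Du Dx ED]] := IHn h2.
  move: hn; rewrite ltnS; apply: leq_trans.
  rewrite Eh size_mul ?monic_neq0 ?monic_exp//.
  have : (1 < size (f ^+ k))%N.
    apply: leq_trans fI.1 _; apply: dvdp_leq.
      by rewrite monic_neq0 ?monic_exp.
    by rewrite dvdp_exp.
  by case: (size _) => [|[|s]]// _; rewrite !addSn /= ltnS leq_addl.
exists ((f, [:: k]) :: D); split.
- rewrite /= Du andbT; apply: contra fNh2 => /mapP[x xD Ex].
  have [_ _ [j j0 Ej]] := Dx x xD.
  by rewrite ED (big_rem x)//= Ej /= addn0 -Ex dvdp_mulr// dvdp_exp.
- move=> x; rewrite inE => /orP[/eqP->|/Dx//] /=; split => //.
  by exists k.
- by rewrite big_cons /= addn0 -ED.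
Qed.

Lemma coprimep_prodr (I : Type) (r : seq I) (P : pred I) (s : I -> {poly F}) p :
  (forall i, P i -> coprimep p (s i)) -> coprimep p (\prod_(i <- r | P i) s i).
Proof.
move=> cp; elim/big_rec: _ => [|i q Pi pq]; first exact: coprimep1.
by rewrite coprimepMr cp.
Qed.

Lemma prod_dvdp (I : finType) (s : I -> {poly F}) p :
  (forall i j, i != j -> coprimep (s i) (s j)) ->
  (\prod_i s i %| p) = [forall i, s i %| p].
Proof.
move=> cp; apply/idP/forallP => [sp i|sp].
  by apply: dvdp_trans sp; rewrite (bigD1 i)//= dvdp_mulr.
rewrite -big_enum; elim: (enum I) (enum_uniq I) => [|i r IHr] /=.
  by rewrite big_nil dvd1p.
move=> /andP[ir ru]; rewrite big_cons Gauss_dvdp ?sp ?IHr//.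
rewrite big_seq; apply: coprimep_prodr => j jr; apply: cp.
by apply: contraNneq ir => ->.
Qed.

(** The Bezout identity for [s i] and the product of the others gives an
    idempotent [e i], congruent to 1 modulo [s i] and to 0 elsewhere. *)
Lemma chinese_poly (I : finType) (s t : I -> {poly F}) :
  (forall i j, i != j -> coprimep (s i) (s j)) ->
  exists p, forall i, s i %| p - t i.
Proof.
move=> cp.
have /choice[e eP] : forall i, exists e, s i %| e - 1 /\
    forall j, j != i -> s j %| e.
  move=> i.
  have /Bezout_eq1_coprimepP[[u v] /= uv] :
      coprimep (s i) (\prod_(j | j != i) s j).
    by apply: coprimep_prodr => j ji; apply: cp; rewrite eq_sym.
  exists (v * \prod_(j | j != i) s j); split.
    by rewrite -[X in _ - X]uv opprD addrCA subrr addr0 -mulNr dvdp_mull.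
  by move=> j ji; rewrite (bigD1 j)//= dvdp_mull// dvdp_mulr.
exists (\sum_i t i * e i) => j; rewrite (bigD1 j)//= addrAC.
rewrite -[t j in X in _ - X]mulr1 -mulrBr dvdp_add//.
  by rewrite dvdp_mull//; case: (eP j).
elim/big_ind: _ => [|p q|i ij]; [exact: dvdp0|exact: dvdp_add|].
by rewrite dvdp_mull//; apply: (eP i).2; rewrite eq_sym.
Qed.

Definition squarefree h : Prop :=
  forall f, f \is monic -> irreducible_poly f -> ~~ (f ^+ 2 %| h).

Definition primary_parts (D : seq ({poly F} * seq nat)) : seq {poly F} :=
  [seq x.1 ^+ sumn x.2 | x <- D].

Section RegularFactorization.
Variables (D : seq ({poly F} * seq nat)) (h : {poly F}).
Hypothesis Dh : regular_factorization D h.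

Lemma prod_primary_parts : h = \prod_(g <- primary_parts D) g.
Proof. by rewrite big_map; case: Dh. Qed.

Lemma primary_parts_coprime (i j : 'I_(size (primary_parts D))) : i != j ->
  coprimep (primary_parts D)`_i (primary_parts D)`_j.
Proof.
have [Du Dx _] := Dh.
have nthE (k : 'I_(size (primary_parts D))) : exists x, [/\ x \in D,
    (primary_parts D)`_k = x.1 ^+ sumn x.2 & [seq y.1 | y <- D]`_k = x.1].
  have kD : (k < size D)%N by rewrite -(size_map (fun x => x.1 ^+ sumn x.2)).
  exists (nth (0, [::]) D k).
  by rewrite !(nth_map (0, [::]))// mem_nth.
have [x [xD -> Ex]] := nthE i; have [y [yD -> Ey]] := nthE j => ij.
have [xm xI _] := Dx x xD; have [ym yI _] := Dx y yD.
apply/coprimep_expl/coprimep_expr; rewrite irreducible_poly_coprime//.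
apply: contra ij => /(irredp_monic_dvd xm ym xI yI) Exy; apply/eqP/val_inj/eqP.
have ltD (k : 'I_(size (primary_parts D))) : (k < size [seq y.1 | y <- D])%N.
  by rewrite size_map -(size_map (fun x => x.1 ^+ sumn x.2)).
by rewrite -(nth_uniq 0 (ltD i) (ltD j) Du) Ex Ey Exy.
Qed.

Lemma primary_partP g : g \in primary_parts D -> exists f k,
  [/\ f \is monic, irreducible_poly f, f %| h, (0 < k)%N & g = f ^+ k].
Proof.
have [_ Dx Eh] := Dh => /mapP[x xD ->]; have [xm xI [k k0 Ek]] := Dx x xD.
exists x.1, k; rewrite Ek /= addn0; split=> //.
by rewrite Eh (big_rem x)//= Ek /= addn0 dvdp_mulr// dvdp_exp.
Qed.

Lemma primary_part_monic g : g \in primary_parts D -> g \is monic.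
Proof. by move=> /primary_partP[f [k [fm _ _ _ ->]]]; apply: monic_exp. Qed.

Lemma primary_part_size g : g \in primary_parts D -> (1 < size g)%N.
Proof.
move=> gD; have g0 := monic_neq0 (primary_part_monic gD).
have [f [k [_ fI _ k0 Eg]]] := primary_partP gD.
by apply: leq_trans fI.1 _; apply: dvdp_leq; rewrite // Eg dvdp_exp.
Qed.

Lemma regular_factorization_dvd f : f \is monic -> irreducible_poly f ->
  f %| h -> f \in [seq x.1 | x <- D].
Proof.
have [_ Dx ->] := Dh => fm fI; rewrite irredp_dvd_prod// => /hasP[x xD fx].
have [xm xI _] := Dx x xD; apply/mapP; exists x => //.
exact: irredp_monic_dvd (irredp_dvdX fI fx).
Qed.

Lemma monic_regular_factorization : h \is monic.
Proof.
have [_ Dx ->] := Dh; rewrite big_seq; apply: monic_prod => x /Dx[xm _ _].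
exact: monic_exp.
Qed.

Lemma squarefree_regular_factorization :
  all (fun x => x.2 == [:: 1%N]) D <-> squarefree h.
Proof.
have [Du Dx Eh] := Dh; split=> [/allP D1 f fm fI|sf]; last first.
  apply/allP => x xD; have [xm xI [k k0 Ek]] := Dx x xD.
  rewrite Ek; case: k k0 Ek => [|[|k]]// _ Ek; have /negP[] := sf _ xm xI.
  rewrite Eh (big_rem x)//= Ek /= addn0 dvdp_mulr// -[k.+2]/(2 + k)%N exprD.
  exact: dvdp_mulIl.
apply/negP => ffh.
have /mapP[x xD Ex] := regular_factorization_dvd fm fI
  (dvdp_trans (dvdp_mulIl f f) ffh).
move: ffh; rewrite Eh (big_rem x)//= (eqP (D1 x xD)) /= -Ex expr2.
rewrite dvdp_mul2l ?irredp_neq0// irredp_dvd_prod// => /hasP[y yD' fy].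
have yD := mem_rem yD'; have [ym yI _] := Dx y yD.
have Ey := irredp_monic_dvd fm ym fI yI (irredp_dvdX fI fy).
move: Du; rewrite (perm_uniq (perm_map _ (perm_to_rem xD))) /= -Ex Ey.
by rewrite map_f.
Qed.

Lemma size_regular_factorization :
  size h = (\sum_(x <- D) sumn x.2 * (size x.1).-1).+1.
Proof.
have [_ Dx ->] := Dh; have {Dx} : forall x, x \in D -> x.1 \is monic.
  by move=> x /Dx[].
elim: D => [|x D' IHD] Dx; first by rewrite !big_nil size_poly1.
have xm : x.1 ^+ sumn x.2 \is monic by rewrite monic_exp// Dx// mem_head.
have {}Dx y : y \in D' -> y.1 \is monic by move=> yD; rewrite Dx// inE yD orbT.
rewrite !big_cons size_Mmonic ?monic_neq0//; last first.
  by rewrite big_seq; apply: monic_prod => y /Dx; apply: monic_exp.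
by rewrite IHD// addnS /= (polySpred (monic_neq0 xm)) size_exp mulnC.
Qed.

End RegularFactorization.

End Factorization.

(** * Roots of [X] modulo a polynomial *)

Section Composition.
Variable F : fieldType.
Implicit Types f g h p q r : {poly F}.

Lemma irredp_X : irreducible_poly ('X : {poly F}).
Proof. by rewrite -['X]subr0; apply: irredp_XsubC. Qed.

Lemma dvdp_comp_sub r p q : p - q %| (r \Po p) - (r \Po q).
Proof.
elim/poly_ind: r => [|r c IHr]; first by rewrite -polyC0 !comp_polyC subrr dvdp0.
rewrite !comp_poly_MXaddC opprD addrACA subrr addr0.
have -> : (r \Po p) * p - (r \Po q) * q =
    ((r \Po p) - (r \Po q)) * p + (r \Po q) * (p - q).
  by rewrite mulrBl mulrBr addrA subrK.
exact: (dvdp_add (dvdp_mulr _ IHr) (dvdp_mulIr _ _)).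
Qed.

(** Substituting [p] for the variable induces a map from [F[X]/(g)] to
    [F[X]/(f)] as soon as [f] divides [g(p)]; both are fields, so it is
    injective. *)
Lemma comp_mod_inj f g p r1 r2 :
    irreducible_poly f -> irreducible_poly g -> f %| g \Po p ->
  (f %| (r1 \Po p) - (r2 \Po p)) = (g %| r1 - r2).
Proof.
move=> fI gI fgp; rewrite -rmorphB /=; apply/idP/idP => [fr|gr]; last first.
  by apply: dvdp_trans fgp _; apply: dvdp_comp_poly.
apply: contraTT fr => gNr; rewrite -irreducible_poly_coprime//.
apply: coprimep_dvdr fgp _; apply: coprimep_comp_poly.
by rewrite irreducible_poly_coprime.
Qed.

(** Since [f] is prime, a factorization of [h(p)] that comes from one of [h]
    has a factor divisible by [f]. *)
Lemma irredp_factor_through f h p : irreducible_poly f -> h != 0 ->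
  f %| h \Po p -> exists2 g, irreducible_poly g & g %| h /\ f %| g \Po p.
Proof.
move=> fI; have [n] := ubnP (size h); elim: n h => // n IHn h hn h0 fh.
have [h1|h1] := leqP (size h) 1.
  have /size_poly1P[c c0 E] : size h == 1.
    by rewrite eqn_leq h1 size_poly_gt0.
  move: fh; rewrite E comp_polyC -[c%:P]mulr1 mul_polyC dvdpZr//.
  by rewrite irredp_dvd1.
have [g [_ gI /dvdpP[k Ek]]] := exists_irredp_dvd h1.
move: fh; rewrite Ek comp_polyM irredp_dvdM// => /orP[fk|fg]; last first.
  by exists g => //; rewrite dvdp_mulIr.
have k0 : k != 0 by apply: contraNneq h0 => E; rewrite Ek E mul0r.
have kn : (size k < n)%N.
  move: hn; rewrite ltnS; apply: leq_trans.
  rewrite Ek size_mul ?(irredp_neq0 gI)//.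
  case: gI => + _; case: (size g) => [|[|s]]// _.
  by rewrite !addnS /= ltnS leq_addr.
have [g' g'I [g'k fg']] := IHn k kn k0 fk.
by exists g' => //; rewrite dvdp_mulr.
Qed.

End Composition.

Section PowerModulo.
Variable F : finFieldType.
Implicit Types f g h p q r : {poly F}.

Let reduce f g p (r : {poly_(size g).-1 F}) : {poly_(size f).-1 F} :=
  npolyp _ ((r \Po p) %% f).

Let size_reduce f p : irreducible_poly f -> (size (p %% f)%R <= (size f).-1)%N.
Proof.
by move=> fI; rewrite -ltnS prednK ?ltn_modp ?size_poly_gt0 ?irredp_neq0.
Qed.

Let reduce_inj f g p :
    irreducible_poly f -> irreducible_poly g -> f %| g \Po p ->
  injective (@reduce f g p).
Proof.
move=> fI gI fgp r1 r2 /(congr1 val) /=; rewrite !npolypK ?size_reduce// => E.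
have : g %| (r1 : {poly F}) - r2.
  by rewrite -(comp_mod_inj _ _ fI gI fgp) /dvdp modpD modpN E subrr.
apply: contraTeq => r12; rewrite gtNdvdp ?subr_eq0 ?(inj_eq val_inj)//.
have lt_g (r : {poly_(size g).-1 F}) : (size (r : {poly F}) < size g)%N.
  by apply: leq_ltn_trans (size_npoly r) _; rewrite prednK// ltnW//; case: gI.
by rewrite (leq_ltn_trans (size_polyD _ _))// size_polyN gtn_max !lt_g.
Qed.

(** Substitution embeds the finite field [F[X]/(g)] in [F[X]/(f)], and the
    cardinals of these fields are powers of that of [F]. *)
Lemma size_comp_dvd f g p :
    irreducible_poly f -> irreducible_poly g -> f %| g \Po p ->
  (size g <= size f)%N.
Proof.
move=> fI gI fgp; have := leq_card _ (reduce_inj fI gI fgp).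
rewrite !card_npoly leq_exp2l ?card_finNzRing_gt1//.
by rewrite -ltnS !prednK// ltnW//; [case: fI|case: gI].
Qed.

(** An injection between finite sets of the same cardinal is onto. *)
Lemma comp_mod_surj f g p r :
    irreducible_poly f -> irreducible_poly g -> f %| g \Po p ->
  size g = size f -> exists r', f %| (r' \Po p) - r.
Proof.
move=> fI gI fgp gf.
have /codomP[r' /(congr1 val) /=] : npolyp _ (r %% f) \in codom (@reduce f g p).
  by apply: inj_card_onto; [exact: reduce_inj|rewrite !card_npoly gf].
rewrite !npolypK ?size_reduce// => E; exists r'.
by rewrite /dvdp modpD modpN E subrr.
Qed.

(** If [g] is a factor of [f(X ^ M)] of the same degree as [f], substituting
    [X ^ M] embeds [F[X]/(f)] in [F[X]/(g)], hence is bijective: the class of [X]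
    in the target has a preimage [p], which is an [M]-th root of the class of
    [X] in the source.  Conversely, given such a root [p], one of the irreducible
    factors [g] of [f(X ^ M)] vanishes at [p], so that there are embeddings in
    both directions and [f] and [g] have the same degree. *)
Lemma M_power_polyP M f : (0 < M)%N -> f \is monic -> irreducible_poly f ->
  M_power_poly M f <-> exists p, f %| p ^+ M - 'X.
Proof.
move=> M0 fm fI; split=> [[_ _ [g [gI gf gs]]]|[p fp]].
  have sgf : size f = size g.
    case: gI fI gs => + _ [+ _].
    by case: (size g) (size f) => [|?] [|?]//= _ _ ->.
  have [p gp] := comp_mod_surj 'X gI fI gf sgf.
  exists p; rewrite -(comp_mod_inj _ _ gI fI gf) rmorphXn /= comp_polyX.
  apply: dvdp_trans gp _.
  by have := dvdp_comp_sub 'X^M (p \Po 'X^M) 'X; rewrite !comp_Xn_poly.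
have ffp : f %| (f \Po 'X^M) \Po p.
  rewrite -comp_polyA comp_Xn_poly.
  have := dvdp_trans fp (dvdp_comp_sub f (p ^+ M) 'X).
  by rewrite comp_polyXr dvdp_subl.
have fM0 : f \Po 'X^M != 0.
  by rewrite comp_poly_eq0 ?monic_neq0// size_polyXn.
have [g gI [gf fg]] := irredp_factor_through fI fM0 ffp.
split=> //; exists g; split => //; congr _.-1; apply/eqP.
by rewrite eqn_leq (size_comp_dvd fI gI fg) (size_comp_dvd gI fI gf).
Qed.

(** A power [Q >= k] of the characteristic turns [f | p ^ M - X] into
    [f ^ Q | p ^ (Q M) - X ^ Q], so [X ^ Q] is an [M]-th power modulo [f ^ k].  As
    [Q] is prime to [M] and [X] is invertible modulo [f ^ k], the class of [X] is
    an [M]-th power as well. *)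
Lemma M_power_lift M f k : (0 < M)%N -> coprime #|F| M -> in_Phi f ->
  (exists p, f %| p ^+ M - 'X) -> exists p, f ^+ k %| p ^+ M - 'X.
Proof.
move=> M0 cFM [fm fI fX] [p fp].
have [c c_pr cF] := finPcharP F.
pose Q := (c ^ k)%N.
have cM : coprime Q M.
  apply/coprimeXl/(coprime_dvdl _ cFM).
  rewrite (dvdn_pcharf cF) -FinRing.zmodXgE; apply/eqP.
  by rewrite -cardsT expg_cardG ?inE.
have kQ : (k <= Q)%N by rewrite ltnW// ltn_expl// prime_gt1.
have fQ : f ^+ k %| p ^+ (Q * M) - 'X^Q.
  have -> : p ^+ (Q * M) - 'X^Q = (p ^+ M - 'X) ^+ Q.
    have Qchar : [pchar {poly F}].-nat Q.
      by rewrite (eq_pnat _ (pchar_poly F)) pnatX (pnatE _ c_pr) cF.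
    by rewrite exprDn_pchar// exprNn_pchar// -exprM mulnC.
  apply: dvdp_trans (dvdp_exp2r _ fp).
  by rewrite dvdp_exp2l.
have [y Xy] : exists y, f ^+ k %| 'X * y - 1.
  have /Bezout_eq1_coprimepP[[u v] /= uv] : coprimep (f ^+ k) 'X.
    apply: coprimep_expl; rewrite irreducible_poly_coprime//; apply/negP => fdX.
    case/eqP: fX; apply: irredp_monic_dvd fdX; rewrite ?monicX//.
    exact: irredp_X.
  exists v; rewrite mulrC -[X in _ - X]uv opprD addrCA subrr addr0 -mulNr.
  exact: dvdp_mulIr.
have Q0 : (0 < Q)%N by rewrite expn_gt0 prime_gt0.
case: (egcdnP M Q0) => a b E _.
have dvdX u v n : f ^+ k %| u - v -> f ^+ k %| u ^+ n - v ^+ n.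
  by move=> uv; rewrite subrXX dvdp_mulr.
(* [a Q = b M + 1] and [y] inverts [X], so that modulo [f ^ k] the [M]-th power of
   the witness is [X ^ (a Q) y ^ (b M) = X]. *)
exists (p ^+ (Q * a) * y ^+ b).
have -> : (p ^+ (Q * a) * y ^+ b) ^+ M - 'X =
    ((p ^+ (Q * M)) ^+ a - 'X^Q ^+ a) * y ^+ (b * M)
    + 'X * (('X * y) ^+ (b * M) - 1 ^+ (b * M)).
  rewrite mulrBl mulrBr expr1n mulr1 exprMn -!exprM mulnAC exprMn mulrA -exprS.
  by rewrite (mulnC Q a) E (eqP cM) addn1 addrA subrK.
exact: (dvdp_add (dvdp_mulr _ (dvdX _ _ _ fQ)) (dvdp_mull _ (dvdX _ _ _ Xy))).
Qed.

(** Roots of [X] modulo the primary parts of [h] are glued by the Chinese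
    remainder theorem. *)
Lemma M_power_modulo M h : (0 < M)%N -> coprime #|F| M -> h \is monic ->
    (forall f, f \is monic -> irreducible_poly f -> f %| h -> in_Phi f) ->
  (exists p, h %| p ^+ M - 'X) <->
  (forall f, f \is monic -> irreducible_poly f -> f %| h -> M_power_poly M f).
Proof.
move=> M0 cFM hm hPhi; split=> [[p hp] f fm fI fh|hM].
  by apply/M_power_polyP => //; exists p; apply: dvdp_trans hp.
have [D Dh] := exists_regular_factorization hm.
rewrite (prod_primary_parts Dh); set s := primary_parts D.
have /choice[t tP] : forall i : 'I_(size s), exists p, s`_i %| p ^+ M - 'X.
  move=> i.
  have [f [k [fm fI fh _ ->]]] := primary_partP Dh (mem_nth 0 (ltn_ord i)).
  apply: (M_power_lift _ M0 cFM (hPhi f fm fI fh)).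
  by apply/M_power_polyP => //; apply: hM.
have [p pP] := chinese_poly t (primary_parts_coprime Dh).
exists p; rewrite (big_nth 0) big_mkord (prod_dvdp _ (primary_parts_coprime Dh)).
apply/forallP => i; rewrite -[p ^+ M](subrK (t i ^+ M)) -addrA.
by rewrite dvdp_add// subrXX dvdp_mulr.
Qed.

End PowerModulo.

(** * Cyclic matrices *)

Section CyclicMatrices.
Variables (F : fieldType) (m : nat).
Implicit Types (A B : 'M[F]_m.+1) (u v w : 'cV[F]_m.+1) (h p q r : {poly F}).

(** [v] generates the module defined by [A] and its annihilator is [(h)], provided
    that [h] has degree [m + 1]: the span of [v] is then [F[X]/(h)], which has the
    dimension of the whole space. *)
Definition cyclic_vector A v h : Prop :=
  forall p, (horner_mx A p *m v == 0) = (h %| p).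

Definition col_poly u : {poly F} := \sum_(j < m.+1) u j 0 *: 'X^j.

Definition krylov A v : 'M[F]_m.+1 :=
  \matrix_(i, j) (A ^+ (j : nat) *m v) i 0.

(** The companion matrix of a polynomial [h] of degree [m + 1]: multiplication by
    [X] on [F[X]/(h)], on the columns of coefficients of remainders.  Its dimension
    does not depend on [h], so matrices for different [h] can be compared. *)
Definition comp_mx h : 'M[F]_m.+1 := \matrix_(i, j < m.+1) ('X^(j.+1) %% h)`_i.

Lemma coef_col_poly u (i : 'I_m.+1) : (col_poly u)`_i = u i 0.
Proof.
rewrite coef_sum (bigD1 i)//= coefZ coefXn eqxx mulr1 big1 ?addr0// => j ji.
by rewrite coefZ coefXn eq_sym (inj_eq val_inj) (negPf ji) mulr0.
Qed.

Lemma col_polyD u v : col_poly (u + v) = col_poly u + col_poly v.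
Proof.
by rewrite -big_split; apply: eq_bigr => j _ /=; rewrite mxE scalerDl.
Qed.

Lemma col_polyZ a u : col_poly (a *: u) = a *: col_poly u.
Proof.
by rewrite scaler_sumr; apply: eq_bigr => j _ /=; rewrite mxE scalerA.
Qed.

Lemma size_col_poly u : (size (col_poly u) <= m.+1)%N.
Proof.
apply: leq_trans (size_sum _ _ _) _; apply/bigmax_leqP => j _.
by apply: leq_trans (size_scale_leq _ _) _; rewrite size_polyXn.
Qed.

Lemma size_modp p h : size h = m.+2 -> (size (p %% h)%R <= m.+1)%N.
Proof. by move=> hs; have := ltn_modp p h; rewrite -size_poly_gt0 hs ltnS. Qed.

Lemma col_polyK r : (size r <= m.+1)%N -> col_poly (\col_j r`_j) = r.
Proof.
move=> rm; apply/polyP => i; have [im|im] := ltnP i m.+1.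
  by rewrite (coef_col_poly _ (Ordinal im)) mxE.
by rewrite !nth_default// (leq_trans _ im)// size_col_poly.
Qed.

Lemma eq_mx_on_deltas A B :
  (forall j, A *m delta_mx j 0 = B *m (delta_mx j 0 : 'cV_m.+1)) -> A = B.
Proof.
move=> AB; apply/matrixP => i j.
by have /colP/(_ i) := AB j; rewrite -!colE !mxE.
Qed.

Lemma col_poly_delta j : col_poly (delta_mx j 0) = 'X^j.
Proof.
rewrite /col_poly (bigD1 j)//= mxE !eqxx scale1r big1 ?addr0// => i ij.
by rewrite mxE (negPf ij) scale0r.
Qed.

Lemma horner_mxM A p q : horner_mx A (p * q) = horner_mx A p *m horner_mx A q.
Proof. exact: rmorphM. Qed.

Lemma mul_krylov A v u : krylov A v *m u = horner_mx A (col_poly u) *m v.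
Proof.
rewrite /col_poly raddf_sum mulmx_suml; apply/colP => i; rewrite !mxE summxE.
apply: eq_bigr => j _.
by rewrite /= horner_mxZ rmorphXn /= horner_mx_X -scalemxAl !mxE mulrC.
Qed.

Section CyclicVector.
Variables (A : 'M[F]_m.+1) (v : 'cV[F]_m.+1) (h : {poly F}).
Hypotheses (Av : cyclic_vector A v h) (hs : size h = m.+2).

Lemma cyclic_modp p : horner_mx A (p %% h) *m v = horner_mx A p *m v.
Proof.
rewrite [in RHS](divp_eq p h) rmorphD mulmxDl /= -[LHS]add0r; congr (_ + _).
by apply/esym/eqP; rewrite Av dvdp_mulIr.
Qed.

Lemma krylov_unit : krylov A v \in unitmx.
Proof.
rewrite -unitmx_tr -row_free_unit; apply: inj_row_free => u /(congr1 trmx).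
rewrite trmx_mul trmxK trmx0 mul_krylov => /eqP; rewrite Av => hu.
have u0 : col_poly u^T = 0.
  by apply: contraTeq hu => u0; rewrite gtNdvdp// hs ltnS size_col_poly.
by apply/rowP => i; rewrite mxE -[u]trmxK mxE -coef_col_poly u0 coef0.
Qed.

Lemma cyclic_span w :
  exists2 r : {poly F}, (size r <= m.+1)%N & w = horner_mx A r *m v.
Proof.
exists (col_poly (invmx (krylov A v) *m w)); first exact: size_col_poly.
by rewrite -mul_krylov mulKVmx// krylov_unit.
Qed.

Lemma cyclic_inj (r1 r2 : {poly F}) :
    (size r1 <= m.+1)%N -> (size r2 <= m.+1)%N ->
  horner_mx A r1 *m v = horner_mx A r2 *m v -> r1 = r2.
Proof.
move=> s1 s2 /eqP; rewrite -subr_eq0 -mulmxBl -rmorphB /= Av => hr.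
apply/eqP; rewrite -subr_eq0; apply: contraTT hr => r0; rewrite gtNdvdp// hs.
by rewrite ltnS (leq_trans (size_polyD _ _))// size_polyN geq_max s1.
Qed.

Lemma cyclic_annihil p : h %| p -> horner_mx A p = 0.
Proof.
move=> hp; apply: eq_mx_on_deltas => j; rewrite mul0mx.
have [r _ ->] := cyclic_span (delta_mx j 0).
rewrite mulmxA -horner_mxM mulrC horner_mxM -mulmxA.
by move: hp; rewrite -Av => /eqP->; rewrite mulmx0.
Qed.

(** The Krylov matrix is the isomorphism from [F[X]/(h)] to the module of [A]. *)
Lemma cyclic_similar_comp_mx :
  exists2 P, P \in unitmx & A *m P = P *m comp_mx h.
Proof.
exists (krylov A v); first exact: krylov_unit.
apply: eq_mx_on_deltas => j; rewrite -!mulmxA !mul_krylov col_poly_delta.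
rewrite -colE mulmxA -{1}(horner_mx_X A) -horner_mxM -exprS -[LHS]cyclic_modp.
congr (horner_mx A _ *m v); rewrite -[LHS]col_polyK; last exact: size_modp.
by congr col_poly; apply/colP => i; rewrite !mxE.
Qed.

End CyclicVector.

(** The annihilator of a cyclic vector kills the whole module, in particular any
    other cyclic vector. *)
Lemma cyclic_unique A v w h1 h2 : size h1 = m.+2 -> size h2 = m.+2 ->
  cyclic_vector A v h1 -> cyclic_vector A w h2 -> h1 %= h2.
Proof.
move=> s1 s2 Av Aw; rewrite /eqp -Av -Aw.
rewrite (cyclic_annihil Aw s2 (dvdpp _)) (cyclic_annihil Av s1 (dvdpp _)).
by rewrite !mul0mx eqxx.
Qed.

Lemma horner_mx_conj A B P p : A *m P = P *m B ->
  horner_mx A p *m P = P *m horner_mx B p.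
Proof.
move=> AP; elim/poly_ind: p => [|p c IHp]; first by rewrite !rmorph0 mul0mx mulmx0.
rewrite !rmorphD /= !rmorphM /= !horner_mx_X !horner_mx_C mulmxDl mulmxDr.
by rewrite -mulmxA AP mulmxA IHp mulmxA scalar_mxC.
Qed.

Lemma cyclic_vector_conj A B P v h : P \in unitmx -> A *m P = P *m B ->
  cyclic_vector B v h -> cyclic_vector A (P *m v) h.
Proof.
move=> PU AP Bv p; rewrite -Bv mulmxA (horner_mx_conj _ AP) -mulmxA.
by apply/eqP/eqP => [E|->]; [rewrite -[LHS](mulKmx PU) E|]; rewrite mulmx0.
Qed.

Lemma col_poly_comp_mx h u : size h = m.+2 ->
  col_poly (comp_mx h *m u) = ('X * col_poly u) %% h.
Proof.
move=> hs; rewrite -[RHS]col_polyK; last exact: size_modp.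
congr col_poly; apply/colP => i; rewrite !mxE /col_poly mulr_sumr.
rewrite (big_morph (fun p => p %% h) (modpD h) (mod0p h)) coef_sum.
apply: eq_bigr => j _.
by rewrite mxE -scalerAr -exprS modpZl coefZ mulrC.
Qed.

Lemma col_poly_horner_comp_mx h p u : size h = m.+2 ->
  col_poly (horner_mx (comp_mx h) p *m u) = (p * col_poly u) %% h.
Proof.
move=> hs; elim/poly_ind: p u => [|p c IHp] u.
  rewrite rmorph0 mul0mx mul0r mod0p /col_poly big1// => j _.
  by rewrite mxE scale0r.
have modM q r : (q * (r %% h)) %% h = (q * r) %% h by rewrite modp_mul.
rewrite rmorphD rmorphM /= horner_mx_X horner_mx_C mulmxDl -mulmxA.
rewrite mul_scalar_mx col_polyD col_polyZ IHp col_poly_comp_mx// modM.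
rewrite mulrDl modpD mulrA mul_polyC modpZl [col_poly u %% h]modp_small//.
by rewrite hs ltnS size_col_poly.
Qed.

Lemma comp_mx_cyclic h : size h = m.+2 ->
  cyclic_vector (comp_mx h) (delta_mx 0 0) h.
Proof.
move=> hs p; rewrite /dvdp -[X in X %% h]mulr1 -[1]/('X^(@ord0 m)) -col_poly_delta.
rewrite -col_poly_horner_comp_mx//.
apply/eqP/eqP => [->|E]; last first.
  by apply/colP => i; rewrite -coef_col_poly E coef0 mxE.
by rewrite /col_poly big1// => j _; rewrite mxE scale0r.
Qed.

(** A [k]-th root [B] of [A] commutes with [A], so it acts as the polynomial [p(A)]
    for which [B v = p(A) v]. *)
Lemma cyclic_power A B v h k : size h = m.+2 -> cyclic_vector A v h ->
  B ^+ k = A -> exists p, h %| p ^+ k - 'X.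
Proof.
move=> hs Av BA; have [p _ Bv] := cyclic_span Av hs (B *m v).
exists p; rewrite -Av rmorphB mulmxBl subr_eq0 /= horner_mx_X -{2}BA rmorphXn /=.
have cBA : comm_mx B A by rewrite -BA; apply: commrX.
apply/eqP; elim: {BA} k => [|k IHk]; first by rewrite !expr0.
have cBp : comm_mx B (horner_mx A p ^+ k).
  by apply: commrX; apply: comm_mx_horner.
rewrite exprSr exprS -[_ * horner_mx A p]/(_ *m _) -[B * _]/(_ *m _).
by rewrite -!mulmxA -Bv -IHk !mulmxA cBp.
Qed.

End CyclicMatrices.

Lemma in_qpoly_eq0 (F : fieldType) (h p : {poly F}) :
  h \is monic -> (1 < size h)%N -> (in_qpoly h p == 0) = (h %| p).
Proof.
move=> hm h1; rewrite -val_eqE /= /mk_monic h1 hm /=.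
by rewrite -(Pdiv.IdomainMonic.modpE hm).
Qed.

Section Modules.
Variables (F : finFieldType) (m : nat).
Implicit Types (A : 'M[F]_m.+1) (v : 'cV[F]_m.+1) (h p : {poly F}).

Section PairwiseCoprime.
Variables (s : seq {poly F}).
Hypotheses (s_monic : forall p, p \in s -> p \is monic)
  (s_size : forall p, p \in s -> (1 < size p)%N)
  (s_coprime : forall i j : 'I_(size s), i != j -> coprimep s`_i s`_j).

Lemma in_qpolys_eq0 p :
  (forall i : 'I_(size s), in_qpoly s`_i p = 0) <-> \prod_(g <- s) g %| p.
Proof.
rewrite (big_nth 0) big_mkord prod_dvdp//; split => [sp|/forallP sp i].
  apply/forallP => i; rewrite -in_qpoly_eq0 ?sp//.
    by rewrite s_monic ?mem_nth.
  by rewrite s_size ?mem_nth.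
by apply/eqP; rewrite in_qpoly_eq0 ?s_monic ?s_size ?mem_nth.
Qed.

(** The element with all components equal to 1 generates the direct sum. *)
Lemma module_iso_cyclic A : module_iso A s ->
  exists v, cyclic_vector A v (\prod_(g <- s) g).
Proof.
case=> phi [[psi phiK psiK] phiD phiM].
have phi0 i : phi 0 i = 0.
  by apply: (addrI (phi 0 i)); rewrite -phiD !addr0.
pose v := psi (fun=> 1).
have phi_v p i : phi (horner_mx A p *m v) i = in_qpoly s`_i p.
  by rewrite phiM psiK mulr1.
exists v => p; apply/eqP/idP => [pv|].
  by apply/in_qpolys_eq0 => i; rewrite -phi_v pv.
move=> /in_qpolys_eq0 sp; rewrite -[LHS]phiK -[RHS]phiK; congr psi.
by apply: functional_extensionality_dep => i; rewrite phi_v sp phi0.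
Qed.

(** The isomorphism sends [r(A) v] to the family of the remainders of [r], which
    is bijective by the Chinese remainder theorem. *)
Lemma cyclic_module_iso A v : cyclic_vector A v (\prod_(g <- s) g) ->
  size (\prod_(g <- s) g) = m.+2 -> module_iso A s.
Proof.
set h := \prod_(g <- s) g => Av hs.
have /choice[r rP] : forall w, exists r : {poly F},
    (size r <= m.+1)%N /\ w = horner_mx A r *m v.
  by move=> w; have [r] := cyclic_span Av hs w; exists r.
have r_mod p : r (horner_mx A p *m v) = p %% h.
  have [sr Er] := rP (horner_mx A p *m v).
  apply: (cyclic_inj Av hs) => //; first exact: size_modp.
  by rewrite -Er (cyclic_modp Av).
have in_qpoly_mod (i : 'I_(size s)) p : in_qpoly s`_i (p %% h) = in_qpoly s`_i p.
  apply/eqP; rewrite -subr_eq0 -rmorphB /=.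
  apply/eqP; move: i; apply/in_qpolys_eq0; rewrite -/h.
  by rewrite [X in _ - X](divp_eq p h) opprD addrCA subrr addr0 dvdpNr dvdp_mulIr.
have r_lin p w : r (horner_mx A p *m w) = (p * r w) %% h.
  by rewrite {1}(rP w).2 mulmxA -horner_mxM r_mod.
have rD v1 v2 : r (v1 + v2) = r v1 + r v2.
  rewrite {1}(rP v1).2 {1}(rP v2).2 -mulmxDl -rmorphD r_mod modp_small//.
  rewrite hs ltnS (leq_trans (size_polyD _ _))// geq_max.
  by rewrite (rP v1).1 (rP v2).1.
exists (fun w (i : 'I_(size s)) => in_qpoly s`_i (r w)); split.
- have /choice[crt crtP] : forall t : (forall i : 'I_(size s), {poly %/ s`_i}),
      exists w, forall i : 'I_(size s), in_qpoly s`_i (r w) = t i.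
    move=> t.
    have [p pP] := chinese_poly (fun i => t i : {poly F}) s_coprime.
    exists (horner_mx A p *m v) => i; rewrite r_mod in_qpoly_mod.
    have [sm s1] : s`_i \is monic /\ (1 < size (s`_i)%R)%N.
      by rewrite s_monic ?s_size ?mem_nth.
    have : in_qpoly s`_i (p - (t i : {poly F})) == 0.
      by rewrite in_qpoly_eq0.
    rewrite rmorphB subr_eq0 => /eqP-> /=.
    by apply: val_inj; exact/in_qpoly_small/size_mk_monic.
  exists crt => [w|t]; last exact/functional_extensionality_dep/crtP.
  rewrite [LHS](rP _).2 [RHS](rP _).2; congr (horner_mx A _ *m v).
  have : h %| r (crt (fun i => in_qpoly s`_i (r w))) - r w.
    by apply/in_qpolys_eq0 => i; rewrite rmorphB /= crtP subrr.
  move=> hr; apply/eqP; rewrite -subr_eq0; apply: contraTT hr => r0.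
  rewrite gtNdvdp// hs ltnS (leq_trans (size_polyD _ _))// size_polyN geq_max.
  by rewrite (rP w).1 (rP (crt _)).1.
- by move=> v1 v2 i; rewrite rD rmorphD.
- by move=> p w i; rewrite r_lin in_qpoly_mod rmorphM.
Qed.

End PairwiseCoprime.
End Modules.

(** * Generating functions of monic polynomials *)

Lemma fps_coefXnM (R : comNzRingType) d (g : fps R) n :
  fps_coef (fpsX ^+ d * g) n = if (d <= n)%N then fps_coef g (n - d) else 0.
Proof.
have -> : fps_coef (fpsX ^+ d * g) n =
    \sum_(i < n.+1) fps_coef (fpsX ^+ d) i * fps_coef g (n - i) by [].
under eq_bigr do rewrite fps_coefXn /=.
have [dn|nd] := leqP d n.
  rewrite (bigD1 (Ordinal (dn : (d < n.+1)%N))) //= eqxx mul1r big1 ?addr0//.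
  by move=> i; rewrite -val_eqE /= => /negPf->; rewrite mul0r.
by rewrite big1// => i _; rewrite (ltn_eqF (leq_trans (ltn_ord i) nd)) mul0r.
Qed.

Section MonicSeries.
Variable F : finFieldType.
Implicit Types (f g h : {poly F}) (P Q : {poly F} -> Prop) (L : seq {poly F}).

(** Polynomials of degree [n] are taken in the finite type of polynomials of size
    at most [n + 1], so that they can be counted. *)
Definition monic_set P n : {set {poly_n.+1 F}} :=
  [set h : {poly_n.+1 F} |
    `[< [/\ (h : {poly F}) \is monic, size (h : {poly F}) = n.+1 & P h] >]].

Definition monic_series P : fps int := Fps (fun n => (#|monic_set P n|)%:Z).

Lemma eq_monic_set P Q n :
    (forall h, h \is monic -> size h = n.+1 -> P h <-> Q h) ->
  monic_set P n = monic_set Q n.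
Proof.
move=> PQ; apply/setP => h; rewrite !inE; apply/asboolP/asboolP.
  by case=> hm hs /(PQ _ hm hs).
by case=> hm hs /(PQ _ hm hs).
Qed.

Lemma card_monic_set_mul f n P : f \is monic ->
  #|monic_set (fun h => exists2 g, h = f * g & P g) (n + (size f).-1)|
    = #|monic_set P n|.
Proof.
move=> fm; have f0 := monic_neq0 fm.
have fs g : size g = n.+1 -> size (f * g) = (n + (size f).-1).+1.
  move=> gs; rewrite size_mul// -?size_poly_gt0 ?gs//.
  by rewrite addnS /= addnC -[in LHS](prednK (n := size f)) ?size_poly_gt0// addnS.
pose t (g : {poly_n.+1 F}) : {poly_(n + (size f).-1).+1 F} := npolyp _ (f * g).
have tE (g : {poly_n.+1 F}) : size (g : {poly F}) = n.+1 -> t g = f * g :> {poly F}.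
  by move=> gs; rewrite npolypK// fs.
rewrite -(@card_in_imset _ _ t (mem (monic_set P n))); last first.
  move=> g1 g2; rewrite !inE => /asboolP[_ s1 _] /asboolP[_ s2 _].
  by move/(congr1 val); rewrite /= !tE// => /(mulfI f0)/val_inj.
congr #|pred_of_set _|; apply/setP => h; rewrite inE; apply/asboolP/imsetP.
  case=> hm hs [g Eg Pg].
  have gs : size g = n.+1.
    have g0 : g != 0.
      by apply: contraNneq (monic_neq0 hm) => g0; rewrite Eg g0 mulr0.
    move: hs; rewrite Eg size_mul//.
    rewrite -[size f in LHS](prednK (n := size f)) ?size_poly_gt0//.
    by rewrite addSn /= -addSn addnC => /addIn.
  have gE : npolyp n.+1 g = g :> {poly F} by rewrite npolypK ?gs.
  exists (npolyp n.+1 g).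
    rewrite inE; apply/asboolP; rewrite gE; split=> //.
    by move: hm; rewrite Eg monicMl.
  by apply: val_inj; rewrite /= tE gE.
case=> g; rewrite inE => /asboolP[gm gs Pg] ->; rewrite tE//; split.
- by rewrite monicMl.
- exact: fs.
- by exists (g : {poly F}).
Qed.

(** The polynomials divisible by [f] are the multiples [f * h], of degree shifted
    by that of [f]. *)
Lemma monic_series_split f P P1 P2 : f \is monic ->
    (forall h, h \is monic -> P1 h <-> P h /\ ~~ (f %| h)) ->
    (forall h, h \is monic -> P2 h <-> P (f * h)) ->
  monic_series P = monic_series P1 + fpsX ^+ (size f).-1 * monic_series P2.
Proof.
move=> fm P1P P2P; apply/fpsP => n.
rewrite -[RHS]/(fps_coef _ n + fps_coef (_ * _) n) fps_coefXnM /=.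
rewrite -(cardsID [set h : {poly_n.+1 F} | f %| h]) addnC PoszD; congr (_ + _).
  congr (Posz #|pred_of_set _|); apply/setP => h; rewrite !inE.
  apply/andP/asboolP => [[fh /asboolP[hm hs Ph]]|[hm hs /P1P[]//]].
    by split => //; apply/P1P.
  by move=> Ph fh; split=> //; apply/asboolP.
have [dn|nd] := leqP; last first.
  apply/eqP; rewrite -[0]/(Posz 0) eqz_nat cards_eq0; apply/eqP/setP => h.
  rewrite !inE; apply/negP => /andP[/asboolP[hm hs _] fh].
  have := dvdp_leq (monic_neq0 hm) fh; rewrite hs leqNgt => /negP; apply.
  by rewrite -ltn_predRL.
rewrite -(card_monic_set_mul _ _ fm) subnK//; congr (Posz #|pred_of_set _|).
apply/setP => h; rewrite !inE; apply/andP/asboolP.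
  move=> [/asboolP[hm hs Ph] /dvdpP[g Eg]]; split=> //; exists g.
    by rewrite mulrC.
  apply/P2P; last by rewrite mulrC -Eg.
  by move: hm; rewrite Eg mulrC monicMl.
move=> [hm hs [g Eg Pg]]; rewrite Eg dvdp_mulIl; split=> //; apply/asboolP.
split=> //; rewrite -?Eg//; rewrite Eg; apply/P2P => //.
by move: hm; rewrite Eg monicMl.
Qed.

Lemma monic_set0 P : P 1 -> #|monic_set P 0| = 1%N.
Proof.
move=> P1; rewrite (_ : monic_set P 0 = [set npolyp 1 1]) ?cards1//.
apply/setP => h; rewrite !inE -val_eqE /= npolypK ?size_poly1//.
apply/asboolP/eqP => [[hm /eqP/size_poly1P[c _ E] _]|->].
  by move: hm; rewrite E monicE lead_coefC => /eqP->.
by rewrite monic1 size_poly1.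
Qed.

Definition supported L h : Prop :=
  forall f, f \is monic -> irreducible_poly f -> f %| h -> f \in L.

Lemma monic_series_nil P :
  P 1 -> (forall h, P h -> supported [::] h) -> monic_series P = 1.
Proof.
move=> P1 Ps; apply/fpsP => -[|n] /=; first by rewrite monic_set0.
apply/eqP; rewrite eqz_nat cards_eq0; apply/eqP/setP => h.
rewrite !inE; apply/negP => /asboolP[hm hs /Ps hL].
by have [|f [fm fI /(hL _ fm fI)]] := @exists_irredp_dvd _ h; rewrite ?hs.
Qed.

Lemma supported1 L : supported L 1.
Proof. by move=> f _ fI; rewrite irredp_dvd1. Qed.

Lemma squarefree1 : squarefree (1 : {poly F}).
Proof.
move=> f _ fI; apply/negP => /(dvdp_trans (dvdp_mulIl f f)).
by rewrite irredp_dvd1.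
Qed.

Section Cons.
Variables (f : {poly F}) (L : seq {poly F}).
Hypotheses (fm : f \is monic) (fI : irreducible_poly f) (fL : f \notin L).

Lemma supported_cons h :
  supported L h <-> supported (f :: L) h /\ ~~ (f %| h).
Proof.
split=> [hL|[hL fh] e em eI eh].
  split=> [e em eI /(hL _ em eI)|]; first by rewrite inE orbC => ->.
  by apply: contra fL => /(hL _ fm fI).
have := hL _ em eI eh; rewrite inE => /orP[/eqP Ee|//].
by rewrite -Ee eh in fh.
Qed.

Lemma supported_mul h : supported (f :: L) h <-> supported (f :: L) (f * h).
Proof.
split=> hL e em eI eh; last by apply: hL; rewrite // dvdp_mull.
move: eh; rewrite irredp_dvdM// => /orP[ef|/(hL _ em eI)//].
by rewrite (irredp_monic_dvd em fm eI fI ef) mem_head.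
Qed.

Lemma squarefree_mul h :
  supported L h /\ squarefree h <->
  supported (f :: L) (f * h) /\ squarefree (f * h).
Proof.
split=> [[hL hS]|[hL hS]].
  have [hfL fh] := (supported_cons h).1 hL.
  split=> [|e em eI]; first by apply/(supported_mul h).
  have [ef|eNf] := boolP (e %| f).
    rewrite (irredp_monic_dvd em fm eI fI ef) expr2.
    by rewrite dvdp_mul2l// monic_neq0.
  by rewrite Gauss_dvdpr ?hS// coprimep_expl// irreducible_poly_coprime.
split=> [|e em eI]; last by apply: contra (hS _ em eI); apply: dvdp_mull.
apply/supported_cons; split; first by apply/(supported_mul h).
by apply: contra (hS _ fm fI); rewrite expr2 dvdp_mul2l// monic_neq0.
Qed.

(** A polynomial supported on [f :: L] is either supported on [L] or [f] times a
    polynomial supported on [f :: L], whence a geometric series. *)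
Lemma monic_series_cons :
  (1 - fpsX ^+ (size f).-1) * monic_series (supported (f :: L)) =
  monic_series (supported L).
Proof.
rewrite mulrBl mul1r.
rewrite {1}(@monic_series_split f _ (supported L) (supported (f :: L)))//.
- by rewrite addrK.
- by move=> h _; apply: supported_cons.
- by move=> h _; apply: supported_mul.
Qed.

(** For squarefree polynomials the cofactor of [f] is supported on [L]. *)
Lemma monic_series_squarefree_cons :
  monic_series (fun h => supported (f :: L) h /\ squarefree h) =
  (1 + fpsX ^+ (size f).-1) *
    monic_series (fun h => supported L h /\ squarefree h).
Proof.
rewrite mulrDl mul1r; apply: monic_series_split => // h _; last exact: squarefree_mul.
by rewrite and_assoc [squarefree h /\ _]and_comm -and_assoc -supported_cons.
Qed.

End Cons.

(** Unique factorization as an Euler product over a finite set of primes. *)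
Lemma monic_series_supported L : uniq L ->
    (forall f, f \in L -> f \is monic /\ irreducible_poly f) ->
  (\prod_(f <- L) (1 - fpsX ^+ (size f).-1)) * monic_series (supported L) = 1.
Proof.
elim: L => [|f L IHL] /=.
  move=> _ _; rewrite big_nil mul1r.
  by apply: monic_series_nil => //; apply: supported1.
move=> /andP[fL Lu] LI; have [fm fI] := LI f (mem_head _ _).
rewrite big_cons [X in X * _]mulrC -mulrA monic_series_cons// IHL// => g gL.
by apply: LI; rewrite inE gL orbT.
Qed.

Lemma monic_series_squarefree L : uniq L ->
    (forall f, f \in L -> f \is monic /\ irreducible_poly f) ->
  monic_series (fun h => supported L h /\ squarefree h) =
    \prod_(f <- L) (1 + fpsX ^+ (size f).-1).
Proof.
elim: L => [|f L IHL] /=.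
  move=> _ _; rewrite big_nil; apply: monic_series_nil => [|h []//].
  by split; [exact: supported1 | exact: squarefree1].
move=> /andP[fL Lu] LI; have [fm fI] := LI f (mem_head _ _).
rewrite big_cons monic_series_squarefree_cons// IHL// => g gL.
by apply: LI; rewrite inE gL orbT.
Qed.

End MonicSeries.

(** * Regular conjugacy classes of powers *)

Section Classes.
Variable F : finFieldType.
Implicit Types (f g h p : {poly F}) (D : comb_data F) (T : pred (seq nat)).

Lemma elem_divisors_regular D h :
  regular_factorization D h -> elem_divisors D = primary_parts D.
Proof.
case=> _ Dx _; rewrite /elem_divisors /primary_parts.
elim: D Dx => //= x D IHD Dx; rewrite IHD => [|y yD]; last first.
  by apply: Dx; rewrite inE yD orbT.
by have [_ _ [k _ ->]] := Dx x (mem_head _ _); rewrite /= addn0.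
Qed.

Section Similarity.
Variable m : nat.
Implicit Type A : 'M[F]_m.+1.

(** A direct sum of cyclic modules with pairwise coprime annihilators is cyclic,
    so one-part combinatorial data are the factorization of the annihilator [h]
    of a cyclic vector. *)
Lemma regular_comb_dataP A T : (forall la, T la -> size la = 1%N) ->
  (exists2 D, has_comb_data A D & all (fun x => T x.2) D) <->
  (exists D h v, [/\ regular_factorization D h, all (fun x => T x.2) D,
    {in D, forall x, x.1 != 'X}, size h = m.+2 & cyclic_vector A v h]).
Proof.
move=> T1; split=> [[D [Du Dx Ds Diso] DT]|[D [h [v [Dh DT DX hs Av]]]]].
  pose h := \prod_(x <- D) x.1 ^+ sumn x.2.
  have Dh : regular_factorization D h.
    split=> // x xD; have [[xm xI _] /and3P[_ _ x0]] := Dx x xD; split=> //.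
    have := T1 _ (allP DT x xD); case: x.2 x0 => [|k []]//= /andP[k0 _] _.
    by exists k.
  have hs : size h = m.+2 by rewrite (size_regular_factorization Dh) Ds.
  have [v Av] := module_iso_cyclic (primary_part_monic Dh)
    (primary_part_size Dh) (primary_parts_coprime Dh)
    (eq_ind _ (module_iso A) Diso _ (elem_divisors_regular Dh)).
  exists D, h, v; split=> // [x xD|]; first by have [[_ _]] := Dx x xD.
  by rewrite (prod_primary_parts Dh).
exists D => //; have [Du Dx Eh] := Dh; split=> //.
- move=> x xD; have [xm xI [k k0 Ek]] := Dx x xD.
  by split; [split=> //; apply: DX | rewrite Ek /nonempty_partition /= k0].
- by apply: succn_inj; rewrite -(size_regular_factorization Dh).
- rewrite (elem_divisors_regular Dh).
  move: Av hs; rewrite (prod_primary_parts Dh); apply: cyclic_module_iso.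
  + exact: primary_part_monic Dh.
  + exact: primary_part_size Dh.
  + exact: primary_parts_coprime Dh.
Qed.

Definition comp_GL h : {'GL_m.+1[F]} := insubd (1%g : {'GL_m.+1[F]}) (comp_mx m h).

Lemma GL_of_unit (U : 'M[F]_m.+1) :
  U \is a GRing.unit -> exists u : {'GL_m.+1[F]}, GLval u = U.
Proof. by move=> Uu; exists (Sub U Uu); apply: SubK. Qed.

Lemma comp_mx_unit h :
  size h = m.+2 -> ~~ ('X %| h) -> comp_mx m h \is a GRing.unit.
Proof.
move=> hs; rewrite -(irreducible_poly_coprime _ (irredp_X F)).
move=> /Bezout_eq1_coprimepP[[a b] /= ab].
have : horner_mx (comp_mx m h) (a * 'X + b * h) = 1 by rewrite ab rmorph1.
rewrite rmorphD !rmorphM /= horner_mx_X.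
rewrite (cyclic_annihil (comp_mx_cyclic hs) hs (dvdpp h)) mulr0 addr0 => aC.
by have [] := mulmx1_unit aC.
Qed.

Lemma comp_GLE h :
  size h = m.+2 -> ~~ ('X %| h) -> GLval (comp_GL h) = comp_mx m h.
Proof. by move=> hs hX; rewrite /comp_GL insubdK//; apply: comp_mx_unit. Qed.

Lemma conj_GLP (a b : {'GL_m.+1[F]}) :
  reflect (exists2 P : 'M[F]_m.+1, P \in unitmx & GLval a *m P = P *m GLval b)
    (b \in (a ^: 'GL_m.+1[F])%g).
Proof.
apply: (iffP imsetP) => [[x _ ->]|[P Pu aP]].
  exists (GLval x); first exact: (valP x).
  exact: (congr1 (fun y : {'GL_m.+1[F]} => GLval y) (conjgC a x)).
have [x Ex] := GL_of_unit Pu; exists x; first by rewrite inE.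
apply: (mulgI x); rewrite conjgE mulgA mulgV mul1g; apply: val_inj => /=.
by rewrite -[LHS]/(GLval x *m GLval b) -[RHS]/(GLval a *m GLval x) Ex.
Qed.

(* [T] selects the partitions allowed in the combinatorial data, and [Q] is the
   property of the annihilator that it amounts to: regular and regular
   semisimple classes are two instances of the same count. *)
Variables (M : nat) (T : pred (seq nat)) (Q : {poly F} -> Prop).
Hypotheses (M0 : (0 < M)%N) (cFM : coprime #|F| M)
  (T1 : forall la, T la -> size la = 1%N)
  (TQ : forall D h, regular_factorization D h -> all (fun x => T x.2) D <-> Q h).

Definition M_power_divisors h : Prop :=
  forall f, f \is monic -> irreducible_poly f -> f %| h ->
    in_Phi f /\ M_power_poly M f.

Let divisors_notX h : M_power_divisors h -> ~~ ('X %| h).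
Proof.
move=> hM; apply/negP => hX.
by have [[_ _ /eqP]] := hM 'X (monicX _) (irredp_X _) hX.
Qed.

(** The class of the companion matrix of [h] determines [h], and the centralizer of
    a cyclic matrix consists of polynomials in it; hence the [M]-th powers among
    these classes are given by the [h] modulo which [X] is an [M]-th power. *)
Lemma card_regular_power_classes :
  #|[set C in classes 'GL_m.+1[F]%g |
      `[< exists2 a : {'GL_m.+1[F]}, a \in C
            & exists2 D, has_comb_data (GLval a) D & all (fun x => T x.2) D >]
      && (C \subset power_image F M m.+1)]|
  = #|monic_set (fun h => M_power_divisors h /\ Q h) m.+1|.
Proof.
pose cl (h : {poly_m.+2 F}) := (comp_GL h ^: 'GL_m.+1[F])%g.
rewrite -(@card_in_imset _ _ cl); last first.
  move=> h1 h2; rewrite !inE.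
  move=> /asboolP[h1m h1s [h1M _]] /asboolP[h2m h2s [h2M _]] E.
  have : comp_GL h1 \in cl h2 by rewrite -E class_refl.
  case/conj_GLP => P Pu; rewrite !comp_GLE ?divisors_notX// => EP.
  have C2 := cyclic_vector_conj Pu EP (comp_mx_cyclic h1s).
  have := cyclic_unique h1s h2s C2 (comp_mx_cyclic h2s).
  by rewrite eqp_monic// => /eqP/val_inj.
congr #|pred_of_set _|; apply/setP => C; rewrite !inE; apply/and3P/imsetP.
- case=> /imsetP[x _ ->] /asboolP[a ax /(regular_comb_dataP _ T1)] + xM.
  case=> D [h [v [Dh DT DX hs Av]]].
  have hm := monic_regular_factorization Dh.
  have hPhi f : f \is monic -> irreducible_poly f -> f %| h -> in_Phi f.
    move=> fm fI fh; split=> //.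
    by have /mapP[y /DX yX ->] := regular_factorization_dvd Dh fm fI fh.
  have hM : M_power_divisors h.
    suff : exists p, h %| p ^+ M - 'X.
      move/(M_power_modulo M0 cFM hm hPhi) => hM f fm fI fh.
      by split; [exact: hPhi | exact: hM].
    have /imsetP[y _ Ey] := subsetP xM a ax.
    apply: (cyclic_power hs Av (B := GLval y)).
    by rewrite Ey [RHS]FinRing.val_unitX.
  have hE : npolyp m.+2 h = h :> {poly F} by rewrite npolypK ?hs.
  exists (npolyp m.+2 h).
    by rewrite inE hE; apply/asboolP; split=> //; split=> //; apply/(TQ Dh).
  rewrite /cl hE -(class_eqP ax); apply/esym/class_eqP/conj_GLP.
  have [P Pu EP] := cyclic_similar_comp_mx Av hs.
  by exists P; rewrite // comp_GLE ?divisors_notX.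
- case=> h; rewrite inE => /asboolP[hm hs [hM hQ]] ->.
  have hX := divisors_notX hM.
  have Ch := comp_mx_cyclic hs.
  split; first by rewrite mem_classes ?inE.
    apply/asboolP; exists (comp_GL h); first exact: class_refl.
    apply/(regular_comb_dataP _ T1).
    have [D Dh] := exists_regular_factorization hm.
    exists D, h, (delta_mx 0 0); split=> //; first exact/(TQ Dh).
      move=> x xD; have [xm xI [k k0 Ek]] := (let: And3 _ Dx _ := Dh in Dx) x xD.
      have [|[]] // := hM x.1 xm xI.
      have [_ _ ->] := Dh.
      by rewrite (big_rem x)//= Ek /= addn0 dvdp_mulr// dvdp_exp.
    by rewrite comp_GLE.
  have [p hp] : exists p, (h : {poly F}) %| p ^+ M - 'X.
    apply/(M_power_modulo M0 cFM hm) => f fm fI fh; by have [] := hM f fm fI fh.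
  have EM : horner_mx (comp_mx m h) p ^+ M = comp_mx m h.
    have /eqP := cyclic_annihil Ch hs hp.
    by rewrite rmorphB rmorphXn /= horner_mx_X subr_eq0 => /eqP.
  have [b Eb] : exists b : {'GL_m.+1[F]}, GLval b = horner_mx (comp_mx m h) p.
    by apply: GL_of_unit; rewrite -(unitrX_pos _ M0) EM comp_mx_unit.
  have bM : (b ^+ M)%g = comp_GL h.
    apply: val_inj.
    by rewrite FinRing.val_unitX /= -[val b]/(GLval b) Eb EM -comp_GLE.
  apply/subsetP => _ /imsetP[x _ ->]; rewrite -bM conjXg.
  by apply: imset_f; rewrite inE.
Qed.

End Similarity.
End Classes.

(** * The [M]-power polynomials as factors of the product *)

Section PowerPolys.
Variables (F : finFieldType) (M : nat).

Definition power_polys d : seq {poly F} :=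
  [seq val f | f in [set f : {poly_d.+1 F} |
      `[< [/\ in_Phi f, M_power_poly M f & (size f).-1 = d] >]]].

Definition power_polys_below N : seq {poly F} :=
  flatten [seq power_polys d | d <- index_iota 1 N].

Lemma mem_power_polys d f : f \in power_polys d <->
  [/\ in_Phi f, M_power_poly M f & (size f).-1 = d].
Proof.
split=> [/imageP[g]|fP]; first by rewrite inE => /asboolP gP ->.
have [[fm _ _] _ fd] := fP.
have fE : npolyp d.+1 f = f :> {poly F}.
  by rewrite npolypK// -fd -(polySpred (monic_neq0 fm)).
by apply/imageP; exists (npolyp d.+1 f); rewrite ?inE /= fE//; apply/asboolP.
Qed.

Lemma mem_power_polys_below N f : f \in power_polys_below N <->
  [/\ in_Phi f, M_power_poly M f & ((size f).-1 < N)%N].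
Proof.
split=> [/flatten_mapP[d]|[fPhi fM fN]].
  by rewrite mem_index_iota => /andP[_ dN] /mem_power_polys[fP fM ->].
apply/flatten_mapP; exists (size f).-1; last exact/mem_power_polys.
rewrite mem_index_iota fN andbT; case: fPhi => _ [f1 _] _.
by rewrite -ltnS prednK// ltnW.
Qed.

Lemma uniq_power_polys_below N : uniq (power_polys_below N).
Proof.
rewrite /power_polys_below; have := iota_uniq 1 (N - 1); rewrite -/(index_iota 1 N).
elim: index_iota => //= d s IHs.
move=> /andP[ds /IHs su]; rewrite cat_uniq su andbT.
rewrite map_inj_uniq ?enum_uniq; last exact: val_inj.
apply/hasPn => f /flatten_mapP[e es /mem_power_polys[_ _ fe]].
apply/negP => /mem_power_polys[_ _ fd].
by move: ds; rewrite -fd fe es.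
Qed.

Lemma prod_power_polys_below (R : comNzRingType) (G : nat -> R) N :
  \prod_(f <- power_polys_below N) G (size f).-1 =
  \prod_(1 <= d < N) G d ^+ N_M F M d.
Proof.
rewrite big_flatten big_map; apply: eq_bigr => d _.
rewrite big_map big_enum -prodr_const; apply: eq_bigr => f.
by rewrite inE => /asboolP[_ _ ->].
Qed.

Lemma power_polys_below_irredp N f : f \in power_polys_below N ->
  f \is monic /\ irreducible_poly f.
Proof. by move=> /mem_power_polys_below[[]]. Qed.

(** The constant coefficients agree because 1 is the only monic polynomial of
    degree 0. *)
Lemma gen_seriesE (c : nat -> nat) n P :
    P 1 -> (forall m, n = m.+1 -> c n = #|monic_set P n|) ->
  fps_coef (gen_series c) n = fps_coef (@monic_series F P) n.
Proof.
move=> P1 cE; rewrite -[LHS]/(_ + _) /=; case: n cE => [|n] cE.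
  by rewrite monic_set0.
by rewrite (cE n).
Qed.

(** Divisors of a polynomial of degree [n < N] have degree less than [N], so that
    truncating the infinite product at [N] does not affect the coefficient of
    degree [n]. *)
Lemma supported_power_polys n N h : h \is monic -> size h = n.+1 -> (n < N)%N ->
  supported (power_polys_below N) h <-> M_power_divisors M h.
Proof.
move=> hm hs nN; split=> hP f fm fI fh.
  by have /mem_power_polys_below[] := hP f fm fI fh.
have [fPhi fM] := hP f fm fI fh; apply/mem_power_polys_below; split=> //.
apply: leq_ltn_trans nN; rewrite -ltnS -hs.
by rewrite prednK ?size_poly_gt0 ?irredp_neq0// dvdp_leq ?monic_neq0.
Qed.

End PowerPolys.

Theorem theorem5p2 (F : finFieldType) (M : nat)
    (hM : (2 <= M)%N) (hqM : coprime #|F| M) :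
  fps_is_infprod (fun d => (1 - fpsX ^+ d) ^- (N_M F M d))
    (gen_series (c_rg F M))
  /\
  fps_is_infprod (fun d => (1 + fpsX ^+ d) ^+ (N_M F M d))
    (gen_series (c_rs F M)).
Proof.
have M0 : (0 < M)%N by apply: ltnW.
split=> n; exists n.+1 => N nN; set L := power_polys_below F M N;
  have Lu : uniq L := uniq_power_polys_below F M N;
  have LI := @power_polys_below_irredp F M N.
- have -> : \prod_(1 <= d < N) (1 - fpsX ^+ d) ^- N_M F M d =
      monic_series (supported L) :> fps int.
    have := monic_series_supported Lu LI.
    rewrite (prod_power_polys_below _ _ (fun d => 1 - fpsX ^+ d)).
    move/(congr1 ( *%R (\prod_(1 <= d < N) (1 - fpsX ^+ d) ^- N_M F M d))).
    rewrite mulr1 mulrA -big_split /= => <-.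
    rewrite big_nat big1 ?mul1r// => d /andP[d0 _].
    by rewrite mulVr// unitrX// fps_unit_1subXn.
  apply/esym/gen_seriesE => [|m Em]; first exact: supported1.
  rewrite Em in nN *.
  rewrite [LHS](card_regular_power_classes m M0 hqM
    (T := fun la => size la == 1%N) (Q := fun=> True)) => [|la /eqP|D h [_ Dx _]]//.
    congr #|pred_of_set _|; apply: eq_monic_set => h hm hs.
    by rewrite (supported_power_polys M hm hs nN); split=> [[]|].
  split=> // _; apply/allP => x /Dx[_ _ [k _ ->]] //.
- rewrite -(prod_power_polys_below _ _ (fun d => 1 + fpsX ^+ d)).
  rewrite -(monic_series_squarefree Lu LI).
  apply/esym/gen_seriesE => [|m Em].
    by split; [exact: supported1|exact: squarefree1].
  rewrite Em in nN *.
  rewrite [LHS](card_regular_power_classes m M0 hqM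
    (T := fun la => la == [:: 1%N]) (Q := @squarefree F)) => [|la /eqP->|D h Dh]//.
    congr #|pred_of_set _|; apply: eq_monic_set => h hm hs.
    by rewrite (supported_power_polys M hm hs nN).
  exact: squarefree_regular_factorization.
Qed.
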